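(* Let $p\geq 5$ be a prime, let $\underline{a}=\{a_n\}_{n=0}^\infty$ be an increasing sequence $a_0<a_1<\cdots$ of non-negative integers, and put $x_n=p^{-(a_n+1)}$ (regarded as an element of $\mathbb{T}$). Then the set $K_{\underline{a},p}=\{0\}\cup\{\pm x_n\mid n\in\mathbb{N}\}$ is quasi-convex in $\mathbb{T}$.
   Context: $\mathbb{N}=\{0,1,2,\dots\}$. Let $\mathbb{T}=\mathbb{R}/\mathbb{Z}$ with quotient map $\pi\colon\mathbb{R}\to\mathbb{T}$; real numbers are identified with their images in $\mathbb{T}$. Put $\mathbb{T}_+=\pi([-\frac14,\frac14])$. For an abelian topological group $G$, $\widehat{G}$ is the group of continuous homomorphisms (characters) $G\to\mathbb{T}$. For $E\subseteq G$ and $A\subseteq\widehat{G}$ put $E^\triangleright=\{\chi\in\widehat{G}\mid\chi(E)\subseteq\mathbb{T}_+\}$ and $A^\triangleleft=\{x\in G\mid\chi(x)\in\mathbb{T}_+\text{ for all }\chi\in A\}$. A set $E\subseteq G$ is quasi-convex in $G$ if $E=E^{\triangleright\triangleleft}$. *)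

(* Defs.v *)
From HB Require Import structures.
From mathcomp Require Import all_boot all_order all_algebra.
From mathcomp Require Import generic_quotient ring_quotient.
From mathcomp Require Import all_classical all_reals all_analysis.
Import Order.TTheory GRing.Theory Num.Theory.
Import numFieldNormedType.Exports.

Set Implicit Arguments.
Unset Strict Implicit.
Unset Printing Implicit Defensive.

Local Open Scope classical_set_scope.
Local Open Scope ring_scope.

Section Circle.
Variable R : realType.

Definition integers : {pred R} := [pred x | x \is a Num.int].

Lemma integers_zmod_closed : zmod_closed integers.
Proof. by split=> [|x y xZ yZ]; [exact: rpred0 | exact: rpredB]. Qed.

HB.instance Definition _ :=
  GRing.isZmodClosed.Build R integers integers_zmod_closed.

(* R/Z with the quotient topology and the quotient group law; the two library
   quotients carry different choice structures, so the group law is transported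
   explicitly. *)
Definition circle := quotient_topology (Quotient.quot integers).

HB.instance Definition _ := Topological.on circle.
HB.instance Definition _ := GRing.isZmodule.Build circle
  (@Quotient.addqA R integers) (@Quotient.addqC R integers)
  (@Quotient.add0q R integers) (@Quotient.addNq R integers).

Definition circle_pi : R -> circle := \pi_(Quotient.quot integers)%qT.

Lemma circle_pi_is_zmod_morphism : zmod_morphism circle_pi.
Proof. exact: pi_is_zmod_morphism. Qed.

HB.instance Definition _ :=
  GRing.isZmodMorphism.Build R circle circle_pi circle_pi_is_zmod_morphism.

Lemma circle_pi_eq (x y : R) :
  (circle_pi x == circle_pi y) = (x - y \is a Num.int).
Proof.
rewrite -[RHS]/(x - y \in integers) Quotient.idealrBE.
by apply/eqP/eqP.
Qed.

Lemma circle_pi_surj (t : circle) : exists x, circle_pi x = t.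
Proof. by exists (repr (t : Quotient.quot integers)); exact: reprK. Qed.

Lemma circle_pi_continuous : continuous circle_pi.
Proof. exact: pi_continuous. Qed.

Lemma circle_pi_open (A : set R) : open A -> open (circle_pi @` A).
Proof.
move=> oA; rewrite /open/= /quotient_open.
have -> : \pi_(Quotient.quot integers)%qT @^-1` (circle_pi @` A) =
    \bigcup_(m : int) ((fun x : R => x + m%:~R) @^-1` A).
  apply/seteqP; split=> [x [y Ay yx] | x [m _ /= Am]].
    have : circle_pi y == circle_pi x by apply/eqP; exact: yx.
    rewrite circle_pi_eq => /intrP[m yxm].
    by exists m => //=; rewrite -yxm addrC subrK.
  exists (x + m%:~R) => //.
  suff /eqP : circle_pi (x + m%:~R) == circle_pi x by [].
  by rewrite circle_pi_eq addrAC subrr add0r intr_int.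
apply: bigcup_open => m _; apply: open_comp => // x _.
by apply: cvgD; [exact: cvg_id | exact: cvg_cst].
Qed.

Lemma circle_sub_continuous :
  continuous (fun t : circle * circle => t.1 - t.2).
Proof.
move=> [s t] U /=.
have [x <-] := circle_pi_surj s; have [y <-] := circle_pi_surj t.
rewrite -[_ - _](raddfB circle_pi) => /(@circle_pi_continuous (x - y)) xyU.
have /= [[A B] /= [xA yB] ABU] := @sub_continuous R^o (x, y) _ xyU.
have pi_nbhs (z : R) (C : set R) : nbhs z C ->
    nbhs (circle_pi z) (circle_pi @` C).
  rewrite nbhsE => -[D [oD Dz] DC].
  apply: (@filterS _ _ _ (circle_pi @` D)); first exact: image_subset.
  by apply: open_nbhs_nbhs; split; [exact: circle_pi_open | exists z].
exists (circle_pi @` A, circle_pi @` B); first by split; exact: pi_nbhs.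
move=> [_ _] /= [[a Aa <-] [b Bb <-]].
by rewrite -[_ - _](raddfB circle_pi); apply: (ABU (a, b)).
Qed.

HB.instance Definition _ :=
  PreTopologicalNmodule_isTopologicalZmodule.Build circle circle_sub_continuous.

Definition circle_plus : set circle :=
  circle_pi @` `[- (1 / 4), 1 / 4].

End Circle.

Arguments circle_plus R : clear implicits.

(* Continuous homomorphisms G -> R/Z; the carrier of the dual group of G. *)
#[short(type="character")]
HB.structure Definition Character (R : realType) (G : topologicalZmodType) :=
  {chi of @GRing.Additive G (circle R) chi & @Continuous G (circle R) chi}.

Section QuasiConvex.
Variables (R : realType) (G : topologicalZmodType).

Definition polar (E : set G) : set (character R G) :=
  [set chi : character R G | chi @` E `<=` circle_plus R].

Definition prepolar (A : set (character R G)) : set G :=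
  [set x | forall chi : character R G, A chi -> circle_plus R (chi x)].

Definition quasi_convex (E : set G) : Prop := E = prepolar (polar E).

End QuasiConvex.

Arguments quasi_convex R {G} E.

Section Sequence.
Variables (R : realType) (a : nat -> nat) (p : nat).

Definition x_seq (n : nat) : circle R := circle_pi (p%:R ^- (a n).+1).

Definition K_set : set (circle R) :=
  [set 0] `|` [set t | exists n, t = x_seq n \/ t = - x_seq n].

End Sequence.

Arguments K_set R a p : clear implicits.

(* Main.v *)
Require Import Defs.
From HB Require Import structures.
From mathcomp Require Import all_boot all_order all_algebra.
From mathcomp Require Import all_classical all_reals all_analysis.
From mathcomp Require Import zify ring lra.
Import Order.TTheory GRing.Theory Num.Theory.

(** Only the characters t |-> k t with k an integer are used: if x lies in the
    bipolar of K, then every k such that all k p^-(a_n+1) are within 1/4 of an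
    integer has k x within 1/4 of an integer.

    Let D be the integer part of (p-1)/4.  An odd p >= 5 satisfies
    4 D < p <= 4 D + 3 and D > 0.  Every k = sum_i d_i p^i with |d_i| <= D is
    admissible, whatever the sequence a: modulo p^e only the digits of index
    below e matter, and they contribute less than p^e / 4 in absolute value
    ([digit_sum_near_int]).

    Let r_i in [-1/4, 1/4] represent p^i x modulo 1.  Adding the terms one at a
    time, with the signs chosen so that nothing cancels, a sum of terms |r_i|
    can never jump from 1/4 or less over the forbidden interval ]1/4, 3/4[, so
    D sum_i |r_i| <= 1/4 ([sum_remainders_le]).  The carries
    c_i = p r_i - r_{i+1} are integers, and a nonzero carry forces
    p |r_i| + |r_{i+1}| >= 1; the bound on the sum has room for at most one of
    those ([carry_unique]).  Where carries vanish, r is a geometric sequence of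
    ratio p, and being bounded it vanishes if this goes on forever.  Hence x is
    an integer when all carries vanish, and x = c / p^(N+1) modulo 1 when c is
    the only nonzero carry, at index N.  Then r_N = c / p, and the same bound
    gives |c| <= p / (4 D) < 2, so x = +- p^-(N+1)
    ([int_or_unit_fraction]).

    Finally, if N is not a term of the sequence a, then k = (D+1) p^N is
    admissible, but k x = +- (D+1)/p is too far from the integers, because
    p/4 < D+1 < 3p/4 ([multiple_near_int], [multiple_not_near_int]).  So N is
    some a_n and x belongs to K. *)

Set Implicit Arguments.
Unset Strict Implicit.
Unset Printing Implicit Defensive.

Local Open Scope classical_set_scope.
Local Open Scope ring_scope.

(** * Distance to the nearest integer *)

Section NearInteger.
Variable R : realType.
Implicit Types x y : R.

Definition near_int x := exists m : int, `|x - m%:~R| <= 1 / 4.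

Lemma circle_plus_piE x : circle_plus R (circle_pi x) <-> near_int x.
Proof.
split=> [[y /=]|[m xm]].
  rewrite in_itv /= => y4 /eqP; rewrite circle_pi_eq => /intrP[m yxm].
  exists (- m); rewrite mulrNz -yxm opprK addrC subrK ler_norml; exact: y4.
exists (x - m%:~R); first by rewrite /= in_itv /= -ler_norml.
by apply/eqP; rewrite circle_pi_eq addrAC subrr add0r rpredN intr_int.
Qed.

Lemma near_int_congr x y : x - y \is a Num.int -> near_int x -> near_int y.
Proof.
move=> /intrP[k xyk] [m xm]; exists (m - k).
by rewrite intrD mulrNz -xyk; congr (_ <= _): xm; congr `|_|; ring.
Qed.

Lemma near_int_opp x : near_int x -> near_int (- x).
Proof.
by move=> [m xm]; exists (- m); rewrite mulrNz -opprD normrN.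
Qed.

(** The gap between 1/4 and 3/4: this is what turns information modulo 1 into
    an inequality between real numbers. *)
Lemma near_int_small x : `|x| <= 1 / 2 -> near_int x -> `|x| <= 1 / 4.
Proof.
move=> x2 [m xm]; suff m0 : m = 0 by move: xm; rewrite m0 subr0.
apply/eqP; rewrite -absz_eq0 -leqn0 -ltnS.
rewrite -ltz_nat abszE -(ltr_int R) intr_norm.
have := ler_normB x (x - m%:~R); rewrite subKr => h.
lra.
Qed.

End NearInteger.

(** * Integers with small digits in base p *)

Section DigitSums.
Variables (p D : nat).
Hypothesis pD : (4 * D < p)%N.

Definition digit_sum (d : nat -> int) n : int := \sum_(i < n) d i * p%:Z ^+ i.

Variable d : nat -> int.
Hypothesis dD : forall i, `|d i| <= D%:Z.

(** By induction, since 4 D + 1 <= p: the geometric sum of the digits is at most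
    D (p^n - 1) / (p - 1) <= (p^n - 1) / 4. *)
Lemma digit_sum_lt n : 4 * `|digit_sum d n| < p%:Z ^+ n.
Proof.
elim: n => [|n IH]; first by rewrite /digit_sum big_ord0 normr0 mulr0.
rewrite /digit_sum big_ord_recr /= -/(digit_sum d n) exprS.
have := ler_normD (digit_sum d n) (d n * p%:Z ^+ n).
rewrite normrM [`|p%:Z ^+ n|]ger0_norm ?exprn_ge0//.
have : `|d n| * p%:Z ^+ n <= D%:Z * p%:Z ^+ n.
  by rewrite ler_wpM2r ?exprn_ge0.
have : (4 * D%:Z + 1) * p%:Z ^+ n <= p%:Z * p%:Z ^+ n.
  by rewrite ler_wpM2r ?exprn_ge0//; lia.
rewrite mulrDl -mulrA; lia.
Qed.

(** The digits of index at least [e] contribute an integer, and the others a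
    number smaller than 1/4. *)
Lemma digit_sum_near_int (R : realType) e n :
  near_int ((digit_sum d n)%:~R * p%:R ^- e : R).
Proof.
have p0 : 0 < p%:R :> R by rewrite ltr0n; lia.
have bounded m : (m <= e)%N ->
    near_int ((digit_sum d m)%:~R * p%:R ^- e : R).
  move=> me; exists 0; rewrite subr0 normrM [`|p%:R ^- e|]ger0_norm; last first.
    by rewrite invr_ge0 exprn_ge0// ltW.
  rewrite ler_pdivrMr ?exprn_gt0// -intr_norm.
  have : p%:R ^+ m <= p%:R ^+ e :> R by rewrite ler_weXn2l// ler1n; lia.
  have := digit_sum_lt m; rewrite -(ltr_int R) intrM rmorphXn /=.
  lra.
elim: n => [|n IH]; first exact: bounded.
have [en|ne] := leqP e n; last exact: bounded.
apply: near_int_congr IH.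
rewrite /digit_sum big_ord_recr /= -mulrBl intrD opprD addrA subrr sub0r mulNr.
have pn : p%:R ^+ n = p%:R ^+ (n - e) * p%:R ^+ e :> R by rewrite -exprD subnK.
rewrite rpredN intrM rmorphXn /= pn mulrA mulfK ?expf_neq0 ?gt_eqF//.
by rewrite rpredM ?intr_int// -natrX natr_int.
Qed.

End DigitSums.

(** * Remainders of the multiples p^i x *)

(** Here [r i] is the representative in [-1/4, 1/4] of p^i x modulo 1. *)
Section SmallRemainders.
Variables (R : realType) (p D : nat) (x : R) (r : nat -> R).
Hypothesis D_gt0 : (0 < D)%N.
Hypothesis digit_sums_near : forall (d : nat -> int) n,
  (forall i, `|d i| <= D%:Z) -> near_int ((digit_sum p d n)%:~R * x).
Hypothesis r_small : forall i, `|r i| <= 1 / 4.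
Hypothesis r_repr : forall i, p%:R ^+ i * x - r i \is a Num.int.

Lemma digit_sum_congr (d : nat -> int) n :
  (digit_sum p d n)%:~R * x - \sum_(i < n) (d i)%:~R * r i \is a Num.int.
Proof.
rewrite /digit_sum raddf_sum /= mulr_suml -sumrB rpred_sum// => i _.
by rewrite intrM rmorphXn /= -mulrA -mulrBr rpredM ?intr_int.
Qed.

(** The sum is built by unit steps [`|r i|], each of them at most 1/4.  Every
    intermediate value differs by an integer from the product of a digit sum
    and [x], so it is near an integer; it is also at most 1/2, hence at most
    1/4. *)
Lemma sum_remainders_le n : D%:R * (\sum_(i < n) `|r i|) <= 1 / 4.
Proof.
elim: n => [|n IH]; first by rewrite big_ord0 mulr0; lra.
suff step j : (j <= D)%N ->
    D%:R * (\sum_(i < n) `|r i|) + j%:R * `|r n| <= 1 / 4.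
  by rewrite big_ord_recr /= mulrDr; exact: step.
elim: j => [|j IHj] jD; first by rewrite mul0r addr0.
(* The sign of [r i] makes each term [d i * r i] a multiple of [`|r i|]. *)
pose d i : int := sgz (r i) * (if (i < n)%N then D else j.+1)%:Z.
have dD i : `|d i| <= D%:Z.
  by rewrite /d; case: sgzP => _; case: ifP => _; lia.
have := near_int_congr (digit_sum_congr d n.+1) (digit_sums_near n.+1 dD).
have -> : \sum_(i < n.+1) (d i)%:~R * r i =
    D%:R * (\sum_(i < n) `|r i|) + j.+1%:R * `|r n|.
  have dr i : (d i)%:~R * r i = (if (i < n)%N then D else j.+1)%:R * `|r i|.
    by rewrite /d intrM [`|r i|]normrEsg sgrEz mulrAC mulrC.
  rewrite big_ord_recr /= dr ltnn mulr_sumr; congr (_ + _).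
  by apply: eq_bigr => i _; rewrite dr ltn_ord.
have S0 : 0 <= D%:R * (\sum_(i < n) `|r i|) by rewrite mulr_ge0// sumr_ge0.
have := r_small n; have := IHj (ltnW jD).
have J0 : 0 <= j%:R * `|r n| by rewrite mulr_ge0.
rewrite -[j.+1%:R]natr1 mulrDl [1 * `|_|]mul1r => u v /near_int_small w.
rewrite -[leLHS]ger0_norm; last by rewrite addr_ge0// addr_ge0.
by apply: w; rewrite ger0_norm ?addr_ge0//; lra.
Qed.

Hypothesis p_lt : (p <= 4 * D + 3)%N.

(** The digits c_i of the expansion r_0 = sum_i c_i p^-(i+1). *)
Definition carry i := p%:R * r i - r i.+1.

Lemma carry_int i : carry i \is a Num.int.
Proof.
have -> : carry i = (p%:R ^+ i.+1 * x - r i.+1) - p%:R * (p%:R ^+ i * x - r i).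
  by rewrite /carry exprS; ring.
by rewrite rpredB ?rpredM ?natr_int.
Qed.

Lemma carry_ge1 i : carry i != 0 -> 1 <= p%:R * `|r i| + `|r i.+1|.
Proof.
move=> c0; apply: (le_trans (norm_intr_ge1 (carry_int i) c0)).
by rewrite (le_trans (ler_normB _ _))// normrM ger0_norm.
Qed.

(** Two nonzero carries give p |r_i| + |r_{i+1}| + p |r_j| + |r_{j+1}| >= 2.
    Since p + 1 <= 8 D, the left-hand side is bounded by 8 D sum_l |r_l|, which
    is at most 2, even when r_{i+1} and r_j are the same term.  The bound is
    strict because |r_i| > 0 occurs with the coefficient p < 8 D. *)
Lemma carry_unique i j : carry i != 0 -> carry j != 0 -> i = j.
Proof.
wlog ij : i j / (i < j)%N.
  move=> H ci cj; have [ij|ji|//] := ltngtP i j; first exact: H.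
  by apply/esym; exact: H.
move=> /carry_ge1 ci /carry_ge1 cj; exfalso.
pose T n := \sum_(l < n) `|r l|.
have TS n : T n.+1 = T n + `|r n| by rewrite /T big_ord_recr.
have T_ge0 n : 0 <= T n by rewrite /T sumr_ge0.
have T_homo : {homo T : m n / (m <= n)%N >-> m <= n}.
  apply: homo_leq => [//|y1 y2 y3|n]; first exact: le_trans.
  by rewrite TS lerDl.
have D1 : 1 <= D%:R :> R by rewrite ler1n.
have Dr l : `|r l| <= D%:R * `|r l| by rewrite ler_peMl.
have pr l : p%:R * `|r l| <= 8 * (D%:R * `|r l|) - `|r l|.
  rewrite -[X in _ <= _ - X]mul1r mulrA -mulrBl ler_wpM2r//.
  by rewrite lerBrDr -natrM natr1 ler_nat; lia.
have ri_gt0 : 0 < `|r i|.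
  rewrite lt_def normr_ge0 andbT; apply/eqP => ri0.
  by have := r_small i.+1; move: ci; rewrite ri0 mulr0; lra.
have : D%:R * T j.+2 <= 1 / 4 by exact: sum_remainders_le.
rewrite 2!TS 2!mulrDr => DS.
have DT : 0 <= D%:R * T i by rewrite mulr_ge0.
have [ji|ji] := leqP j i.+1.
  have E : j = i.+1 by lia.
  move: DS cj; rewrite E TS mulrDr => DS cj.
  move: (pr i) (pr i.+1) (Dr i.+2) ci cj DS DT ri_gt0 (normr_ge0 (r i.+2)).
  clear.
  move: (p%:R * _) (p%:R * _) (D%:R * T i) (D%:R * _) (D%:R * _) (D%:R * _).
  move=> *; lra.
have : D%:R * T i.+2 <= D%:R * T j by rewrite ler_wpM2l// T_homo.
rewrite 2!TS 2!mulrDr.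
move: (pr i) (pr j) (Dr i.+1) (Dr j.+1) ci cj DS DT ri_gt0.
move: (normr_ge0 (r j)) (normr_ge0 (r i.+1)) (normr_ge0 (r j.+1)).
clear.
move: (p%:R * _) (p%:R * _) (D%:R * T i) (D%:R * T j).
move: (D%:R * `|r i|) (D%:R * `|r j|) (D%:R * _) (D%:R * _).
move=> *; lra.
Qed.

Lemma remainders_geometric m n :
  (forall i, (m <= i < m + n)%N -> carry i = 0) -> r (m + n)%N = p%:R ^+ n * r m.
Proof.
elim: n => [|n IH] c0; first by rewrite addn0 mul1r.
have /eqP : carry (m + n) = 0 by apply: c0; lia.
rewrite addnS subr_eq0 => /eqP <-.
by rewrite IH ?exprS ?mulrA// => i ?; apply: c0; lia.
Qed.

Hypothesis p_gt1 : (1 < p)%N.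

(** A nonzero geometric sequence of ratio p > 1 leaves [-1/4, 1/4]. *)
Lemma remainder_eq0 m : (forall i, (m <= i)%N -> carry i = 0) -> r m = 0.
Proof.
move=> c0; apply/eqP; apply: contraT => rm0.
have rm_gt0 : 0 < `|r m| by rewrite normr_gt0.
pose n := Num.bound `|r m|^-1.
have /archi_boundP : 0 <= `|r m|^-1 by rewrite invr_ge0.
rewrite -/n => nP; have : n%:R <= p%:R ^+ n :> R.
  by rewrite -natrX ler_nat ltnW// ltn_expl.
have := r_small (m + n)%N.
rewrite remainders_geometric => [|i /andP[mi _]]; last exact: c0.
rewrite normrM ger0_norm ?exprn_ge0// => h1 h2.
have : 1 < p%:R ^+ n * `|r m|.
  by rewrite -ltr_pdivrMr// mul1r (lt_le_trans nP).
lra.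
Qed.

Lemma int_or_unit_fraction : x \is a Num.int \/
  exists N, x - p%:R ^- N.+1 \is a Num.int \/ x + p%:R ^- N.+1 \is a Num.int.
Proof.
have p0 : 0 < p%:R :> R by rewrite ltr0n; lia.
have xr0 : x - r 0%N \is a Num.int by have := r_repr 0; rewrite mul1r.
have [c0|] := pselect (forall i, carry i = 0).
  by left; move: xr0; rewrite remainder_eq0 ?subr0.
move=> /existsNP[N /eqP cN]; right; exists N.
have c0 i : i != N -> carry i = 0.
  by apply: contra_neq_eq => ci; exact: carry_unique.
have rN1 : r N.+1 = 0.
  by apply: remainder_eq0 => i Ni; apply: c0; rewrite gtn_eqF.
have rN : r N = p%:R ^+ N * r 0%N.
  have := @remainders_geometric 0 N; rewrite add0n; apply => i iN.
  by apply: c0; lia.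
have cr0 : carry N = p%:R ^+ N.+1 * r 0%N.
  by rewrite /carry rN1 rN subr0 exprS mulrA.
(* As r_N = c / p, the bound D |r_N| <= 1/4 leaves |c| <= p / (4 D) < 2. *)
have c2 : `|carry N| < 2.
  have := sum_remainders_le N.+1; rewrite big_ord_recr /= mulrDr.
  have S0 : 0 <= D%:R * (\sum_(i < N) `|r i|) by rewrite mulr_ge0// sumr_ge0.
  rewrite /carry rN1 subr0 normrM ger0_norm//.
  have : p%:R * `|r N| <= (4 * D%:R + 3) * `|r N|.
    by rewrite ler_wpM2r// -natrM -natrD ler_nat.
  have := r_small N; lra.
have /intrP[c cE] := carry_int N.
have r0E : r 0%N = c%:~R * p%:R ^- N.+1.
  by rewrite -cE cr0 mulrAC mulfV ?mul1r// expf_neq0// gt_eqF.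
move: cN c2; rewrite cE intr_eq0 -intr_norm (ltr_int R _ 2) => c_neq0 c2.
have [c1|c1] : c = 1 \/ c = -1 by lia.
  by left; move: xr0; rewrite r0E c1 mul1r.
by right; move: xr0; rewrite r0E c1 mulN1r opprK.
Qed.

End SmallRemainders.

(** * A multiple that separates p^-(N+1) from the other powers *)

Section SeparatingMultiple.
Variables (R : realType) (p m N : nat).
Hypothesis p_gt0 : (0 < p)%N.

(** Multiplying p^-e by m p^N gives an integer when e <= N, and at most m / p^2
    when e >= N + 2. *)
Lemma multiple_near_int e : (4 * m <= p ^ 2)%N -> e != N.+1 ->
  near_int ((m * p ^ N)%N%:R * p%:R ^- e : R).
Proof.
move=> mp eN; have p0 : 0 < p%:R :> R by rewrite ltr0n.
have [lt_eN|le_Ne] := leqP e N.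
  apply: (@near_int_congr _ 0); last by exists 0; rewrite subr0 normr0.
  rewrite sub0r rpredN natrM natrX -(subnK lt_eN) exprD mulrA mulfK.
    by rewrite -natrX -natrM natr_int.
  by rewrite expf_neq0// gt_eqF.
exists 0; rewrite subr0 ger0_norm ?mulr_ge0// ?invr_ge0 ?exprn_ge0//.
rewrite ler_pdivrMr ?exprn_gt0// mulrAC ler_pdivlMr// mul1r.
rewrite -natrX -!natrM ler_nat mulnAC [(m * 4)%N]mulnC.
have e2 : (N + 2 <= e)%N by rewrite addn2 ltn_neqAle eq_sym eN.
by apply: leq_trans (leq_pexp2l p_gt0 e2); rewrite expnD mulnC leq_mul2l mp orbT.
Qed.

Lemma multiple_not_near_int : (p < 4 * m < 3 * p)%N ->
  ~ near_int ((m * p ^ N)%N%:R * p%:R ^- N.+1 : R).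
Proof.
move=> /andP[pm mp] [k].
have p0 : 0 < p%:R :> R by rewrite ltr0n.
have -> : (m * p ^ N)%N%:R * p%:R ^- N.+1 = m%:R / p%:R :> R.
  by rewrite natrM natrX exprSr invfM mulrA mulfK// expf_neq0// gt_eqF.
have q1 : 1 < 4 * (m%:R / p%:R) :> R.
  by rewrite mulrA ltr_pdivlMr// mul1r -natrM ltr_nat.
have q3 : 4 * (m%:R / p%:R) < 3 :> R.
  by rewrite mulrA ltr_pdivrMr// -!natrM ltr_nat.
rewrite ler_norml => /andP[kq qk].
have [k0|k1] := leP k 0.
  by have kR : k%:~R <= 0 :> R; [rewrite lerz0|lra].
by have kR : 1 <= k%:~R :> R; [rewrite ler1z|lra].
Qed.

End SeparatingMultiple.

(** * Multiplication by an integer as a character of the circle *)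

Section CircleMultiplication.
Variable R : realType.

(** A named copy of [*~], on which the instances of additive and continuous map
    can be declared. *)
Definition circle_mul (k : int) (t : circle R) : circle R := t *~ k.

Lemma circle_mul_zmod_morphism k : zmod_morphism (circle_mul k).
Proof. by move=> s t; rewrite /circle_mul mulrzBl. Qed.

HB.instance Definition _ k := GRing.isZmodMorphism.Build (circle R) (circle R)
  (circle_mul k) (circle_mul_zmod_morphism k).

Lemma circle_mulrn_continuous n : continuous (fun t : circle R => t *+ n).
Proof.
elim: n => [|n IH] t; first exact: cst_continuous.
rewrite (_ : (fun _ => _) = fun t => t + t *+ n); last first.
  by apply/funext => s; rewrite mulrS.
exact: (cvg_comp2 cvg_id (IH t) (@add_continuous _ (t, _))).
Qed.

Lemma circle_mul_continuous k : continuous (circle_mul k).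
Proof.
move=> t; case: k => n; first exact: circle_mulrn_continuous.
exact: (continuous_comp (@circle_mulrn_continuous n.+1 t) (@opp_continuous _ _)).
Qed.

HB.instance Definition _ k :=
  isContinuous.Build (circle R) (circle R) (circle_mul k) (@circle_mul_continuous k).

Lemma circle_mul_pi k (y : R) :
  circle_mul k (circle_pi y) = circle_pi (k%:~R * y).
Proof. by rewrite mulrzl raddfMz. Qed.

Lemma prepolar_polar_near_int (E : set (circle R)) (x : R) (k : int) :
  @prepolar R _ (polar E) (circle_pi x) ->
  (forall y, E (circle_pi y) -> near_int (k%:~R * y)) -> near_int (k%:~R * x).
Proof.
move=> Ex Ek; apply/circle_plus_piE; rewrite -circle_mul_pi.
apply: (Ex (circle_mul k : character R (circle R))) => _ [t Et <-].
have [y yt] := circle_pi_surj t; subst t.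
by rewrite /= circle_mul_pi; apply/circle_plus_piE; exact: Ek.
Qed.

End CircleMultiplication.

(** * Quasi-convexity *)

Lemma K_set_near_int (R : realType) (p : nat) (a : nat -> nat) (k : int) (y : R) :
  (forall n, near_int (k%:~R * p%:R ^- (a n).+1 : R)) ->
  K_set R a p (circle_pi y) -> near_int (k%:~R * y).
Proof.
move=> ka [y0|[n [yn|yn]]].
- apply: (@near_int_congr _ 0); last by exists 0; rewrite subr0 normr0.
  have /eqP : circle_pi y = circle_pi 0 by rewrite raddf0.
  rewrite circle_pi_eq subr0 => yZ.
  by rewrite sub0r rpredN rpredM ?intr_int.
- move/eqP: yn; rewrite eq_sym /x_seq circle_pi_eq => yn.
  by apply: near_int_congr (ka n); rewrite -mulrBr rpredM ?intr_int.
- move/eqP: yn; rewrite eq_sym /x_seq -raddfN circle_pi_eq => yn.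
  apply: near_int_congr (near_int_opp (ka n)).
  by rewrite -mulrN -mulrBr rpredM ?intr_int.
Qed.

Lemma digit_sum_single p i : digit_sum p (fun j => (j == i)%:Z) i.+1 = p%:Z ^+ i.
Proof.
rewrite /digit_sum big_ord_recr /= eqxx mul1r big1 ?add0r// => j _.
by rewrite ltn_eqF// mul0r.
Qed.

Theorem theoremC (R : realType) (p : nat) (a : nat -> nat)
    (p_prime : prime p) (p_ge5 : (5 <= p)%N)
    (a_increasing : forall n, (a n < a n.+1)%N) :
  quasi_convex R (K_set R a p).
Proof.
apply/seteqP; split=> [t Kt chi chiK|t]; first by apply: chiK; exists t.
have [x <- xK] := circle_pi_surj t.
have H (k : int) : (forall n, near_int (k%:~R * p%:R ^- (a n).+1 : R)) ->
    near_int (k%:~R * x).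
  move=> ka; apply: (prepolar_polar_near_int xK) => y.
  exact: K_set_near_int.
pose D := (p.-1 %/ 4)%N.
have [D_gt0 pD pD3] : [/\ (0 < D)%N, (4 * D < p)%N & (p <= 4 * D + 3)%N].
  have p_odd : odd p by case: (even_prime p_prime) => // p2; lia.
  by rewrite /D; split; lia.
have digit_sums_near (d : nat -> int) n : (forall i, `|d i| <= D%:Z) ->
    near_int ((digit_sum p d n)%:~R * x).
  by move=> dD; apply: H => e; exact: (digit_sum_near_int pD).
(* The power p^i is itself a digit sum, so p^i x has a small remainder. *)
have /choice[r rP] i : exists y : R,
    `|y| <= 1 / 4 /\ p%:R ^+ i * x - y \is a Num.int.
  have [|m xm] := @digit_sums_near (fun j => (j == i)%:Z) i.+1.
    by move=> j; case: eqP => _; lia.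
  rewrite digit_sum_single rmorphXn /= in xm.
  by exists (p%:R ^+ i * x - m%:~R); split=> //; rewrite subKr intr_int.
have [||||||xZ|[N xN]] := @int_or_unit_fraction R p D x r => //.
- by move=> i; case: (rP i).
- by move=> i; case: (rP i).
- by lia.
- by left; apply/eqP; rewrite -(raddf0 (@circle_pi R)) circle_pi_eq subr0.
have [[n aN]|naN] := pselect (exists n, a n = N).
  right; exists n; rewrite /x_seq aN -raddfN.
  by case: xN => xN; [left|right]; apply/eqP; rewrite circle_pi_eq ?opprK.
(* If no a_n equals N, then (D+1) p^N belongs to the polar but moves [x] too
   far from the integers. *)
exfalso; apply: (@multiple_not_near_int R p D.+1 N); [lia|lia|].
have k_near : near_int ((D.+1 * p ^ N)%N%:R * x).
  apply: (H (D.+1 * p ^ N)%N%:Z) => n; apply: multiple_near_int; [lia|nia|].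
  by apply/eqP => -[aN]; apply: naN; exists n.
case: xN => xN.
  by apply: near_int_congr k_near; rewrite -mulrBr rpredM ?natr_int.
rewrite -[X in near_int X]opprK -mulrN; apply: near_int_opp.
by apply: near_int_congr k_near; rewrite -mulrBr opprK rpredM ?natr_int.
Qed.
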